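(* For every $w\in S_{\mathbb Z}$, the shifted SEM expansion of $\mathfrak S_{\gamma^m(w)}$ has constant support and coefficients for all sufficiently large $m$. That is, there exist an integer $m_0\ge 0$, a finite set $A\subset\mathcal C$ and nonzero rational numbers $(c_\alpha)_{\alpha\in A}$ such that for every integer $m\ge m_0$: $\gamma^m(w)\in S_\infty$, the index $\gamma^m(\alpha)$ is admissible for every $\alpha\in A$, and $$\mathfrak S_{\gamma^m(w)}=\sum_{\alpha\in A}c_\alpha\,\mathbf e_{\gamma^m(\alpha)}.$$
   Context: Indices. $\mathcal C$ is the set of finitely supported tuples $\alpha=(\alpha_i)_{i\in\mathbb Z}$ of nonnegative integers, with shift $\gamma(\alpha)_i=\alpha_{i-1}$. Ordinary SEMs. An index $a\in\mathcal C$ is admissible if it is supported on positive integers and $a_i\le i$ for all $i\ge 1$; then $\mathbf e_a=\prod_{i\ge 1}\mathbf e_{a_i}(x_1,\ldots,x_i)$, a product of elementary symmetric polynomials, is the ordinary standard elementary monomial (SEM). The ordinary SEMs form a $\mathbb Q$-basis of $\mathbb Q[x_1,x_2,\ldots]$ (Fomin–Gelfand–Postnikov). Permutations. $S_{\mathbb Z}$ is the group of permutations of $\mathbb Z$ moving only finitely many integers; $S_\infty\subset S_{\mathbb Z}$ is the subgroup of those fixing every $i\le 0$; $s_i=(i,i+1)$; $\ell$ is Coxeter length. The shift acts on $S_{\mathbb Z}$ by $\gamma(w)(i)=w(i-1)+1$. Schubert polynomials. For $u\in S_\infty$, $\mathfrak S_u$ is the usual Schubert polynomial: $\mathfrak S_{w_0}=x_1^{n-1}x_2^{n-2}\cdots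 x_{n-1}$ for the longest $w_0\in S_n$, and $\partial_i\mathfrak S_u=\mathfrak S_{us_i}$ whenever $\ell(us_i)<\ell(u)$, where $\partial_i f=(f-s_if)/(x_i-x_{i+1})$. *)

(* Defs.v *)
From HB Require Import structures.
From mathcomp Require Import all_boot all_order all_algebra.
From mathcomp Require Import finmap monalg.

Set Implicit Arguments.
Unset Strict Implicit.
Unset Printing Implicit Defensive.

Import Order.TTheory GRing.Theory Num.Theory.

Local Open Scope fset_scope.
Local Open Scope ring_scope.

(* Finitely supported tuples of nonnegative integers indexed by Z. *)
Definition Cindex : choiceType := {fsfun int -> nat with 0%N}.

Definition gamma_index (a : Cindex) : Cindex :=
  [fsfun i in [fset j + 1 | j in finsupp a] => a (i - 1) | 0%N].

Lemma gamma_indexE (a : Cindex) (i : int) : gamma_index a i = a (i - 1).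
Proof.
rewrite fsfun_fun; case: ifP => // /negbT ni.
rewrite fsfun_dflt //; apply: contra ni => ai.
by apply/imfsetP; exists (i - 1) => //=; rewrite subrK.
Qed.

Definition admissible (a : Cindex) : Prop :=
  (forall i : int, i <= 0 -> a i = 0%N)
  /\ (forall i : nat, (1 <= i)%N -> (a i%:Z <= i)%N).

(* Finitely supported injective maps Z -> Z are exactly the permutations of Z
   moving finitely many integers; Leibniz equality on SZ is extensional. *)
Record SZ := MkSZ { szval :> {fsfun int -> int}; _ : fsinjectiveb szval }.

HB.instance Definition _ := [isSub for szval].
HB.instance Definition _ := [Choice of SZ by <:].

Lemma szP (u v : SZ) : (forall i, u i = v i) <-> u = v.
Proof. by split=> [/fsfunP/val_inj | ->]. Qed.

Lemma sz_inj (u : SZ) : injective u.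
Proof. by case: u => u hu; exact/fsinjectiveP. Qed.

Section OfFun.

Variables (D : {fset int}) (f : int -> int).
Hypotheses (f_inj : injective f) (f_out : forall i, i \notin D -> f i = i).

Lemma sz_of_funE0 : [fsfun i in D => f i | i] =1 f.
Proof. by move=> i; rewrite fsfun_fun; case: ifP => // /negbT /f_out. Qed.

Lemma sz_of_fun_subproof : fsinjectiveb [fsfun i in D => f i | i].
Proof. by apply/fsinjectiveP => i j; rewrite !sz_of_funE0 => /f_inj. Qed.

Definition sz_of_fun : SZ := MkSZ sz_of_fun_subproof.

Lemma sz_of_funE i : sz_of_fun i = f i.
Proof. exact: sz_of_funE0. Qed.

End OfFun.

Definition sz1_fun (i : int) : int := i.

Lemma sz1_out i : i \notin (fset0 : {fset int}) -> sz1_fun i = i.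
Proof. by []. Qed.

Definition sz1 : SZ := sz_of_fun (@inj_id int) sz1_out.

Lemma szM_subproof (u v : SZ) : fsinjectiveb (fsfun_comp u v).
Proof. by apply/fsinjectiveP/fscomp_inj; exact: sz_inj. Qed.

Definition szM (u v : SZ) : SZ := MkSZ (szM_subproof u v).

Lemma szME (u v : SZ) i : szM u v i = u (v i).
Proof. exact: fscompE. Qed.

Definition adj_fun (i j : int) : int :=
  if j == i then i + 1 else if j == i + 1 then i else j.

Lemma adj_fun_inj i : injective (adj_fun i).
Proof.
apply: (can_inj (g := adj_fun i)) => j; rewrite /adj_fun.
have ii1 : (i + 1 == i) = false.
  by apply/negbTE; rewrite -subr_eq0 addrAC subrr add0r oner_eq0.
case: (eqVneq j i) => [->|ji]; first by rewrite ii1 eqxx.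
by case: (eqVneq j (i + 1)) => [->|ji1]; rewrite ?eqxx // (negbTE ji) (negbTE ji1).
Qed.

Lemma adj_fun_out i j : j \notin [fset i; i + 1] -> adj_fun i j = j.
Proof. by rewrite /adj_fun !inE negb_or => /andP[/negbTE-> /negbTE->]. Qed.

(* The adjacent transposition (i, i + 1). *)
Definition adj (i : int) : SZ := sz_of_fun (@adj_fun_inj i) (@adj_fun_out i).

Definition gamma_fun (w : SZ) (i : int) : int := w (i - 1) + 1.

Lemma gamma_fun_inj w : injective (gamma_fun w).
Proof. by move=> i j /addIr /sz_inj /addIr. Qed.

Lemma gamma_fun_out (w : SZ) i :
  i \notin [fset j + 1 | j in finsupp (szval w)] -> gamma_fun w i = i.
Proof.
move=> ni; rewrite /gamma_fun fsfun_dflt ?subrK //; apply: contra ni => wi.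
by apply/imfsetP; exists (i - 1) => //=; rewrite subrK.
Qed.

Definition gamma (w : SZ) : SZ := sz_of_fun (@gamma_fun_inj w) (@gamma_fun_out w).

Definition in_Sinfty (w : SZ) : Prop := forall i : int, i <= 0 -> w i = i.

Definition longest_fun (n : nat) (i : int) : int :=
  if (1 <= i) && (i <= n%:Z) then n%:Z + 1 - i else i.

Lemma longest_fun_inj n : injective (longest_fun n).
Proof.
apply: (can_inj (g := longest_fun n)) => i; rewrite /longest_fun.
case: (boolP ((1 <= i) && (i <= n%:Z))) => [/andP[i1 ni]|/negbTE ni]; last by rewrite ni.
have -> : 1 <= n%:Z + 1 - i by rewrite lerBrDr addrC lerD2r.
have -> : n%:Z + 1 - i <= n%:Z by rewrite lerBlDr lerD2l.
by rewrite /= opprB addrC subrK.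
Qed.

Lemma longest_fun_out n i :
  i \notin [fset k%:Z | k in iota 1 n] -> longest_fun n i = i.
Proof.
rewrite /longest_fun; case: ifP => // /andP[i1 ni] /negP[].
case: i i1 ni => // k k1 kn; apply/imfsetP; exists k => //=.
by rewrite mem_iota add1n ltnS; apply/andP.
Qed.

(* The longest element n ... 2 1 of S_n. *)
Definition longest (n : nat) : SZ :=
  sz_of_fun (@longest_fun_inj n) (@longest_fun_out n).

Definition word (s : seq int) : SZ := foldr (fun i v => szM (adj i) v) sz1 s.

(* [has_length w k] is the graph of the Coxeter length of S_Z: k is the least
   number of adjacent transpositions in a word for w. *)
Definition has_length (w : SZ) (k : nat) : Prop :=
  (exists s : seq int, word s = w /\ size s = k)
  /\ (forall s : seq int, word s = w -> (k <= size s)%N).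

Definition length_lt (u v : SZ) : Prop :=
  exists k l : nat, [/\ has_length u k, has_length v l & (k < l)%N].

(* Q[x_1, x_2, ...]. The generator indexed by k : nat is the variable x_{k+1},
   so that [xvar i] is x_i for i >= 1; [xvar 0] is never used. *)
Notation Qx := {malg rat[{cmonom nat}]}.

Definition xvar (i : nat) : Qx := << ucm i.-1 >>.

Definition swap_nat (i j : nat) : nat :=
  if j == i then i.+1 else if j == i.+1 then i else j.

Definition swap_monom (i : nat) (m : {cmonom nat}) : Qx :=
  \prod_(k <- finsupp m) xvar (swap_nat i k.+1) ^+ m k.

(* s_i f: exchange x_i and x_{i+1} in f. *)
Definition swap (i : nat) (f : Qx) : Qx := mmap malgC (swap_monom i) f.

(* [divdiff i f g] says g = (f - s_i f) / (x_i - x_{i+1}), the quotient in the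
   integral domain Q[x_1, x_2, ...]. *)
Definition divdiff (i : nat) (f g : Qx) : Prop :=
  (xvar i - xvar i.+1) * g = f - swap i f.

Definition elem_sym (k i : nat) : Qx :=
  \sum_(B : {set 'I_i} | #|B| == k) \prod_(j in B) xvar j.+1.

(* The factors with a i = 0 are e_0 = 1, so the product may be restricted to
   the support of a. *)
Definition sem (a : Cindex) : Qx :=
  \prod_(i <- finsupp a | 1 <= i) elem_sym (a i) `|i|%N.

(* The family of Schubert polynomials; only its values on S_infty are
   constrained, and these are determined uniquely. *)
Definition schubert_family (S : SZ -> Qx) : Prop :=
  (forall n : nat, S (longest n) = \prod_(1 <= i < n) xvar i ^+ (n - i))
  /\ (forall (u : SZ) (i : nat), in_Sinfty u -> (1 <= i)%N ->
        length_lt (szM u (adj i%:Z)) u ->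
        divdiff i (S u) (S (szM u (adj i%:Z)))).

(* Main.v *)
Require Import Defs.
From HB Require Import structures.
From mathcomp Require Import all_boot all_order all_algebra.
From mathcomp Require Import perm finmap monalg.
From mathcomp Require Import ring zify.

(** Call a sequence [f] of polynomials stable if, for all large [m],
    [f m] is a combination of SEMs whose indices are shifted [m] times, the
    combination itself being independent of [m]. Because the straightening
    relation
      [e_p(X_n) e_q(X_n) = e_p(X_n) e_q(X_(n+1)) - e_(q-1)(X_n) e_(p+1)(X_(n+1))
                           + e_(p+1)(X_n) e_(q-1)(X_n)]
    does not mention [n] in its coefficients, stable sequences are closed under
    multiplication by [e_q(X_(k+m))]. The only factor of [e_a] that is not
    symmetric in [x_k, x_(k+1)] is [e_(a_k)(X_k)], whose divided difference is
    [e_(a_k - 1)(X_(k-1))]; so they are closed under divided differences at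
    [k + m] too. Every permutation of an interval is reached from the longest
    one by such divided differences, and the Schubert polynomial of the
    [m]-shifted longest element is a Jacobi-Trudi determinant of fixed size in
    the [e_q(X_(k+m))], hence stable. *)

Set Implicit Arguments.
Unset Strict Implicit.
Unset Printing Implicit Defensive.

Import Order.TTheory GRing.Theory Num.Theory.

Local Open Scope fset_scope.
Local Open Scope ring_scope.

(** * Permutations of the integers and their inversions *)

Lemma iter_gammaE m w i : iter m gamma w i = w (i - m%:Z) + m%:Z.
Proof.
elim: m i => [|m IH] i; first by rewrite /= subr0 addr0.
rewrite iterS sz_of_funE /gamma_fun IH.
have -> : i - 1 - m%:Z = i - m.+1%:Z by lia.
by rewrite -addrA -PoszD addn1.
Qed.

Lemma adjE i j : adj i j = adj_fun i j.
Proof. exact: sz_of_funE. Qed.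

Lemma sz1E i : sz1 i = i.
Proof. exact: sz_of_funE. Qed.

Lemma szM_adjE (u : SZ) i j : szM u (adj i) j = u (adj_fun i j).
Proof. by rewrite szME adjE. Qed.

Lemma adj_funK i : involutive (adj_fun i).
Proof. move=> j; rewrite {2}/adj_fun; case: (j =P i) => [->|ji].
  by rewrite /adj_fun; do !case: eqP => ?; lia.
by case: (j =P i + 1) => [->|?]; rewrite /adj_fun; do !case: eqP => ?; lia. Qed.

Lemma szM_adjK (u : SZ) i : szM (szM u (adj i)) (adj i) = u.
Proof. by apply/szP => j; rewrite !szM_adjE adj_funK. Qed.

Lemma adj_funl i : adj_fun i i = i + 1.
Proof. by rewrite /adj_fun eqxx. Qed.

Lemma adj_funr i : adj_fun i (i + 1) = i.
Proof. by rewrite -(adj_funl i) adj_funK. Qed.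

Lemma iter_gammaM_adj m u i :
  iter m gamma (szM u (adj i)) = szM (iter m gamma u) (adj (i + m%:Z)).
Proof.
apply/szP => j; rewrite iter_gammaE !szM_adjE iter_gammaE.
congr (u _ + _); by rewrite /adj_fun; do !case: eqP => ? //; lia.
Qed.

Definition fixes_outside (c d : int) (u : SZ) :=
  forall i, ~~ (c <= i < d) -> u i = i.

Lemma fixes_outside_stable c d u i :
  fixes_outside c d u -> c <= i < d -> c <= u i < d.
Proof.
move=> uP icd; apply: contraT => ui.
by have /sz_inj e := uP _ ui; rewrite e icd in ui.
Qed.

Lemma fixes_outsideM_adj c d u i :
  fixes_outside c d u -> c <= i -> i + 1 < d ->
  fixes_outside c d (szM u (adj i)).
Proof.
move=> uP ci id j jcd; rewrite szM_adjE /adj_fun.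
by rewrite !ifN ?uP //; apply: contraNneq jcd => ->; lia.
Qed.

Definition int_range (c : int) (n : nat) : {fset int} :=
  [fset c + k%:Z | k in iota 0 n].

Lemma in_int_range c n i : (i \in int_range c n) = (c <= i < c + n%:Z).
Proof.
apply/imfsetP/idP => [[k /=]|icn]; first by rewrite mem_iota => ? ->; lia.
by exists `|i - c|%N; rewrite /= ?mem_iota; lia.
Qed.

Definition is_inversion (u : SZ) (p : int * int) :=
  (p.1 < p.2) && (u p.2 < u p.1).

Lemma inversion_int_range c n u p :
  fixes_outside c (c + n%:Z) u -> is_inversion u p ->
  p \in int_range c n `*` int_range c n.
Proof.
case: p => a b uP /andP[/= ab uba]; rewrite inE /= !in_int_range.
have := @fixes_outside_stable _ _ _ a uP.
have := @fixes_outside_stable _ _ _ b uP.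
case: (boolP (c <= a < _)) => [|/[dup] ? /uP ?];
  case: (boolP (c <= b < _)) => [|/[dup] ? /uP ?] //;
  by lia.
Qed.

Definition radius (u : SZ) : nat := (\max_(i <- finsupp (szval u)) `|i|).+1%N.

Lemma fixes_outside_radius u :
  fixes_outside (- (radius u)%:Z) (- (radius u)%:Z + (radius u).*2%:Z) u.
Proof.
move=> i ni; rewrite fsfun_dflt //; apply/negP => iu.
have := @leq_bigmax_seq _ _ xpredT (fun j : int => `|j|%N) i iu isT.
by rewrite -ltnS -/(radius u); lia.
Qed.

(** A window containing the support makes the set finite; by [in_inversions] it loses no
    inversion. *)
Definition inversions (u : SZ) : {fset int * int} :=
  let I := int_range (- (radius u)%:Z) (radius u).*2 in
  [fset p in I `*` I | is_inversion u p].

Lemma in_inversions u p : (p \in inversions u) = is_inversion u p.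
Proof.
by rewrite 2!inE /= andb_idl //; apply/inversion_int_range/fixes_outside_radius.
Qed.

Lemma card_inversions_le c n u : fixes_outside c (c + n%:Z) u ->
  (#|` inversions u| <= #|` int_range c n `*` int_range c n|)%N.
Proof.
move=> uP; apply: fsubset_leq_card; apply/fsubsetP => p.
by rewrite in_inversions; exact: inversion_int_range.
Qed.

Lemma adj_fun_lt i (a b : int) :
  a < b -> (a, b) != (i, i + 1) -> adj_fun i a < adj_fun i b.
Proof. by rewrite xpair_eqE /adj_fun; do !case: eqP => ? //=; lia. Qed.

(** Applying [adj_fun i] to both coordinates maps the inversions of [szM u (adj i)] bijectively onto
    those of [u] other than [(i, i + 1)]. *)
Lemma card_inversions_descent (u : SZ) i : u (i + 1) < u i ->
  #|` inversions u| = #|` inversions (szM u (adj i))|.+1.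
Proof.
move=> ui; pose f p : int * int := (adj_fun i p.1, adj_fun i p.2).
have fK : involutive f by case=> a b; rewrite /f /= !adj_funK.
have -> : inversions u =
    (i, i + 1) |` [fset f p | p in inversions (szM u (adj i))].
  apply/fsetP => p; rewrite in_fset1U in_inversions.
  have [-> | pi] := eqVneq p; first by rewrite /is_inversion /= ui; lia.
  rewrite -[in RHS](fK p) (mem_imfset _ _ (inv_inj fK)) in_inversions.
  case: p pi => a b ab; rewrite /is_inversion /= !szM_adjE !adj_funK.
  apply/andP/andP => -[lt_ab uba]; split=> //; first exact: adj_fun_lt.
  rewrite -(adj_funK i a) -(adj_funK i b); apply: adj_fun_lt => //.
  apply: contraL uba => /eqP[/(canRL (adj_funK i)) -> /(canRL (adj_funK i)) ->].
  by rewrite adj_funl adj_funr -leNgt ltW.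
rewrite cardfsU1 card_imfset; last exact: inv_inj.
rewrite -[(i, i + 1)]fK (mem_imfset _ _ (inv_inj fK)) in_inversions.
by rewrite /is_inversion /= adj_funl adj_funr [_ + 1 < i]ltNge ltW //; lia.
Qed.

Lemma word_rcons s i : word (rcons s i) = szM (word s) (adj i).
Proof.
elim: s => [|j s IH] /=; apply/szP => k; rewrite !szME ?sz1E //.
by rewrite IH !szME.
Qed.

Lemma card_inversions_word s : (#|` inversions (word s)| <= size s)%N.
Proof.
elim/last_ind: s => [|s i IH].
  rewrite leqn0 cardfs_eq0; apply/eqP/fsetP => p; rewrite in_inversions !inE.
  by rewrite /is_inversion !sz1E; lia.
rewrite word_rcons size_rcons; have [h|h] := ltP (word s (i + 1)) (word s i).
  by rewrite (card_inversions_descent h) in IH; lia.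
rewrite (@card_inversions_descent _ i) ?szM_adjK //.
rewrite !szM_adjE adj_funl adj_funr lt_neqAle h andbT.
by apply/eqP => /sz_inj; lia.
Qed.

Lemma descent_between (u : SZ) a (n : nat) :
  u (a + n.+1%:Z) < u a -> exists2 i, a <= i <= a + n%:Z & u (i + 1) < u i.
Proof.
elim: n => [|n IH] h; first by exists a => //; lia.
have [h1|h1] := ltP (u (a + n.+2%:Z)) (u (a + n.+1%:Z)).
  exists (a + n.+1%:Z); first lia.
  by have -> : a + n.+1%:Z + 1 = a + n.+2%:Z by lia.
have [i ian ui] := IH (le_lt_trans h1 h).
by exists i => //; lia.
Qed.

(** Such a [u] rises by at least [n] over [n] steps. Comparison with a fixed point far to the right
    gives [u i <= i], and with one far to the left [i <= u i]. *)
Lemma increasing_sz1 (u : SZ) : (forall i, u i < u (i + 1)) -> u = sz1.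
Proof.
move=> uP; apply/szP => i; rewrite sz1E.
have up (n : nat) j : u j + n%:Z <= u (j + n%:Z).
  elim: n => [|n IH]; first by rewrite !addr0.
  have := uP (j + n%:Z); rewrite -addrA -PoszD addn1.
  by move: (u (j + _)) (u (j + _)) IH => v v' ? ?; lia.
have fixed j : (radius u < `|j|)%N -> u j = j.
  by move=> ij; apply: fixes_outside_radius; lia.
pose n := (`|i| + radius u).+1.
have := up n i; rewrite (fixed (i + _)) ?lerD2r; last by rewrite /n; lia.
have := up n (i - n%:Z).
rewrite (fixed (i - _)) ?subrK; last by rewrite /n; lia.
by move=> h1 h2; apply/eqP; rewrite eq_le h1 h2.
Qed.

(** Bubble sort: an inversion forces a descent between its ends, and exchanging there removes
    exactly one inversion. *)
Lemma inversions_word u :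
  exists s, word s = u /\ size s = #|` inversions u|.
Proof.
have [n] := ubnP #|` inversions u|; elim: n u => // n IH u un.
have [e|[[a b]]] := fset_0Vmem (inversions u).
  exists [::]; rewrite e cardfs0; split=> //=; apply/esym/increasing_sz1 => i.
  rewrite lt_neqAle (inj_eq (@sz_inj u)) lt_eqF ?ltrDl //= leNgt.
  apply/negP => ui; suff : (i, i + 1) \in inversions u by rewrite e.
  by rewrite in_inversions /is_inversion /= ui ltrDl.
rewrite in_inversions => /andP[/= ab uba].
have [|i _ ui] := @descent_between u a `|b - a|.-1.
  by have -> : a + `|b - a|.-1.+1%:Z = b by lia.
have := card_inversions_descent ui => ci.
have [|s [su ss]] := IH (szM u (adj i)); first by lia.
by exists (rcons s i); rewrite word_rcons su szM_adjK size_rcons ss ci.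
Qed.

Lemma has_length_inversions u : has_length u #|` inversions u|.
Proof.
by split=> [|s <-]; [exact: inversions_word | exact: card_inversions_word].
Qed.

Lemma length_lt_descent (u : SZ) i :
  u (i + 1) < u i -> length_lt (szM u (adj i)) u.
Proof.
move=> ui; exists #|` inversions (szM u (adj i))|, #|` inversions u|.
split; try exact: has_length_inversions.
by rewrite (card_inversions_descent ui).
Qed.

(** * Exchanging two variables *)

Lemma swap_monomM i :
  {morph swap_monom i : m1 m2 / mmul m1 m2 >-> m1 * m2}.
Proof.
move=> m1 m2; rewrite /swap_monom mdomD.
rewrite (big_fset_incl _ (fsubsetUl (finsupp m1) (finsupp m2))); last first.
  by move=> k _; rewrite -cmE_eq0 => /eqP ->; rewrite expr0.
rewrite (big_fset_incl _ (fsubsetUr (finsupp m1) (finsupp m2))); last first.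
  by move=> k _; rewrite -cmE_eq0 => /eqP ->; rewrite expr0.
by rewrite -big_split; apply: eq_bigr => k _; rewrite cmM exprD.
Qed.

Lemma swap_monom1 i : swap_monom i mone = 1.
Proof. by rewrite /swap_monom mdom1 big_seq_fset0. Qed.

HB.instance Definition _ i :=
  isMultiplicative.Build {cmonom nat} Qx (swap_monom i)
    (conj (@swap_monomM i) (swap_monom1 i)).

HB.instance Definition _ i := GRing.RMorphism.copy (swap i)
  (mmap malgC (swap_monom i)).

Lemma swap_xvar i j : swap i (xvar j.+1) = xvar (swap_nat i j.+1).
Proof.
rewrite /swap mmapU mul1r /swap_monom mdomU big_seq_fset1.
by rewrite cmUU expr1.
Qed.

Lemma mcoeff_xvarM i (g : Qx) m :
  (xvar i * g)@_m = \sum_(k <- msupp g) g@_k *+ (mmul (ucm i.-1) k == m).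
Proof.
rewrite (mcoeffMlw _ msuppU_le (fsubset_refl (msupp g))) big_seq_fset1.
by apply: eq_bigr => k _; rewrite mcoeffUU mul1r.
Qed.

Lemma mcoeff_xvarMU i (g : Qx) m : (xvar i * g)@_(mmul (ucm i.-1) m) = g@_m.
Proof.
have inj k : (mmul (ucm i.-1) k == mmul (ucm i.-1) m) = (k == m).
  apply/eqP/eqP => [e|->//]; apply/eqP/cmP => j.
  by have := congr1 (fun u : {cmonom nat} => u j) e; rewrite !cmM => /addnI.
rewrite mcoeff_xvarM; under eq_bigr do rewrite inj.
rewrite [RHS](congr1 (mcoeff m) (monalgE g)) raddf_sum /=.
by apply: eq_bigr => k _; rewrite mcoeffU.
Qed.

Lemma mcoeff_xvarM0 i (g : Qx) (m : {cmonom nat}) :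
  m i.-1 = 0%N -> (xvar i * g)@_m = 0.
Proof.
move=> m0; rewrite mcoeff_xvarM big1 // => k _.
by case: eqP => // e; move: m0; rewrite -e cmM cmUU.
Qed.

Lemma xvarB_reg i : (0 < i)%N -> GRing.lreg (xvar i - xvar i.+1).
Proof.
move=> i0 g h /eqP; rewrite -subr_eq0 -mulrBr mulrBl subr_eq0 => /eqP e.
apply/eqP; rewrite -subr_eq0; apply/eqP/malgP => m; rewrite mcoeff0.
move: {g h}(g - h) e => g e.
(* Since [x_i g = x_(i+1) g], the coefficient of [g] at [m] equals the one at [m x_i / x_(i+1)].
   Each such move lowers the exponent [m i] of [x_(i+1)]; once it is 0, the coefficient vanishes. *)
have [n] := ubnP (m i); elim: n m => [m|n IH m mn]; first by rewrite ltn0.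
rewrite -(mcoeff_xvarMU i) e; have [m0|m0] := posnP (m i).
  by apply: mcoeff_xvarM0; rewrite cmM cmU /= m0; case: eqP; lia.
pose m' := mmul (ucm i.-1) (divcm m (ucm i)).
have -> : (mmul (ucm i.-1) m) = (mmul (ucm i) m').
  apply/eqP/cmP => j; rewrite !cmM divcmE !cmU.
  case: (eqVneq i j) => [<-|_]; last by rewrite add0n subn0.
  by rewrite addnCA subnKC.
rewrite (mcoeff_xvarMU i.+1); apply: IH; rewrite cmM divcmE cmU cmUU.
by case: eqP; lia.
Qed.

Lemma divdiff_inj i f g h :
  (0 < i)%N -> divdiff i f g -> divdiff i f h -> g = h.
Proof. by move=> i0 fg fh; apply: (xvarB_reg i0); rewrite fg fh. Qed.

(** * Elementary symmetric polynomials *)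

Section ElementarySymmetric.

Variables (R : comNzRingType) (x : nat -> R).

(* Extending the degree to negative integers by zero makes the recursion
   [elem_symzS] uniform. *)
Definition elem_symz (q : int) (n : nat) : R :=
  if q is Posz k then \sum_(B : {set 'I_n} | #|B| == k) \prod_(j in B) x j.+1
  else 0.

Lemma elem_symz_coef (k n : nat) :
  elem_symz k n = (\prod_(j < n) (1 + (x j.+1)%:P * 'X) : {poly R})`_k.
Proof.
under eq_bigr do rewrite addrC.
rewrite bigA_distr coef_sum /= big_mkcond /=; apply: eq_bigr => B _.
rewrite -big_mkcond /= big_split /= prodr_const -rmorph_prod mul_polyC coefZ.
by rewrite coefXn eq_sym; case: ifP => _; rewrite ?mulr1 ?mulr0.
Qed.

Lemma elem_symz0 n : elem_symz 0 n = 1.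
Proof.
rewrite elem_symz_coef -horner_coef0 horner_prod big1 // => j _.
by rewrite !hornerE.
Qed.

Lemma elem_symzS q n :
  elem_symz q n.+1 = elem_symz q n + x n.+1 * elem_symz (q - 1) n.
Proof.
case: q => [[|k]|k]; last by rewrite /= mulr0 addr0.
  by rewrite !elem_symz0 mulr0 addr0.
have -> : k.+1%:Z - 1 = k by lia.
rewrite !elem_symz_coef big_ord_recr /=.
by rewrite mulrDr mulr1 mulrCA coefD coefCM coefMX.
Qed.

Lemma elem_symz0n q : elem_symz q 0 = (q == 0)%:R.
Proof.
case: q => [k|k] //; rewrite elem_symz_coef big_ord0 coef1.
by case: k.
Qed.

Lemma elem_symz_gt (q : int) n : n%:Z < q -> elem_symz q n = 0.
Proof.
elim: n q => [|n IH] q nq; first by rewrite elem_symz0n gt_eqF.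
by rewrite elem_symzS !IH ?mulr0 ?addr0 //; lia.
Qed.

Lemma elem_symz_lt0 (q : int) n : q < 0 -> elem_symz q n = 0.
Proof. by case: q. Qed.

Lemma elem_symzn (n : nat) : elem_symz n n = \prod_(1 <= j < n.+1) x j.
Proof.
elim: n => [|n IH]; first by rewrite elem_symz0 big_nil.
rewrite elem_symzS elem_symz_gt ?add0r; last by lia.
have -> : n.+1%:Z - 1 = n by lia.
by rewrite IH [RHS]big_nat_recr //= mulrC.
Qed.

(** After both factors in [n.+1] variables are expanded by [elem_symzS], the two terms carrying
    [x n.+1] cancel. *)
Lemma elem_symz_straighten p q n :
  elem_symz p n * elem_symz q n = elem_symz p n * elem_symz q n.+1
    - elem_symz (q - 1) n * elem_symz (p + 1) n.+1
    + elem_symz (p + 1) n * elem_symz (q - 1) n.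
Proof. by rewrite (elem_symzS q) (elem_symzS (p + 1)) addrK; ring. Qed.

Section Swap.

Variables (s : {rmorphism R -> R}) (i : nat).
Hypotheses (i_gt0 : (0 < i)%N).
Hypothesis sx : forall j, s (x j.+1) = x (swap_nat i j.+1).

Lemma swap_elem_symz_lt q n : (n < i)%N -> s (elem_symz q n) = elem_symz q n.
Proof.
elim: n q => [|n IH] q ni; first by rewrite elem_symz0n rmorph_nat.
rewrite elem_symzS rmorphD rmorphM /= sx !IH ?(ltnW ni) //.
by rewrite /swap_nat !ifN //; apply/eqP; lia.
Qed.

(** For [n < i] neither exchanged variable occurs. For [n = i.+1] two uses of the recursion give an
    expression symmetric in both, and [s] fixes all further variables. *)
Lemma swap_elem_symz q n : n != i -> s (elem_symz q n) = elem_symz q n.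
Proof.
have [ni _|] := ltnP n i; first exact: swap_elem_symz_lt.
rewrite leq_eqVlt eq_sym => /predU1P[->|lin _]; first by rewrite eqxx.
rewrite -(subnKC lin); move: (n - i.+1)%N => d {lin}.
elim: d q => [|d IH] q.
  case: i i_gt0 sx swap_elem_symz_lt => // k _ sx' sE.
  rewrite addn0 !elem_symzS !(rmorphD, rmorphM) /= !sx' !sE //.
  have -> : swap_nat k.+1 k.+1 = k.+2 by rewrite /swap_nat eqxx.
  have -> : swap_nat k.+1 k.+2 = k.+1 by rewrite /swap_nat ifN ?eqxx ?gtn_eqF.
  by ring.
rewrite addnS elem_symzS rmorphD rmorphM /= !IH sx.
by rewrite /swap_nat !ifN //; apply/eqP; lia.
Qed.

Lemma divdiff_elem_symz q :
  (x i - x i.+1) * elem_symz (q - 1) i.-1 = elem_symz q i - s (elem_symz q i).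
Proof.
case: i i_gt0 sx swap_elem_symz_lt => // k _ sx' sE.
rewrite /= elem_symzS rmorphD rmorphM /= sx' !sE // /swap_nat eqxx.
by ring.
Qed.

End Swap.

End ElementarySymmetric.

Arguments elem_symz : simpl never.

(** * The staircase determinant *)

(** Row [a0] of [A] is its image under [s] plus [c] times row [a0] of [B], and the other rows are
    shared; the determinant is linear in row [a0]. *)
Lemma det_divdiff_row (R : comNzRingType) (s : {rmorphism R -> R}) (c : R) n
    (a0 : 'I_n) (A B : 'M[R]_n) :
  (forall a b, a != a0 -> s (A a b) = A a b /\ B a b = A a b) ->
  (forall b, c * B a0 b = A a0 b - s (A a0 b)) ->
  c * \det B = \det A - s (\det A).
Proof.
move=> AB Ba0; suff {1}-> : \det A = 1 * \det (map_mx s A) + c * \det B.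
  by rewrite det_map_mx mul1r addrC addKr.
apply: (determinant_multilinear (i0 := a0)).
- by apply/rowP => b; rewrite !mxE mul1r Ba0 addrC subrK.
- apply/matrixP => a b; rewrite !mxE.
  by have [|-> _] // := AB (lift a0 a) b; rewrite eq_sym neq_lift.
- apply/matrixP => a b; rewrite !mxE.
  by have [|_ ->] // := AB (lift a0 a) b; rewrite eq_sym neq_lift.
Qed.

Lemma det_add_row (R : comNzRingType) (c : R) n (a0 a1 : 'I_n) (A B : 'M[R]_n) :
  a0 != a1 ->
  (forall a b, a != a0 -> B a b = A a b) ->
  (forall b, B a0 b = A a0 b + c * A a1 b) ->
  \det B = \det A.
Proof.
move=> a01 AB Ba0.
pose C := \matrix_(a, b) (if a == a0 then A a1 b else A a b).
rewrite (@determinant_multilinear _ _ B A C a0 1 c).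
- rewrite (@determinant_alternate _ _ C a0 a1) ?mul1r ?mulr0 ?addr0 // => b.
  by rewrite !mxE eqxx eq_sym (negbTE a01).
- by apply/rowP => b; rewrite !mxE eqxx mul1r Ba0.
- by apply/matrixP => a b; rewrite !mxE AB // eq_sym neq_lift.
- apply/matrixP => a b.
  by rewrite !mxE AB eq_sym ?neq_lift // (negbTE (neq_lift _ _)).
Qed.

Section Staircase.

Variables (R : comNzRingType) (x : nat -> R).

(* The Jacobi-Trudi type determinant for the staircase partition
   (n, n - 1, ..., 1), whose row [a] is flagged by [x_1, ..., x_(m+a+1)]. *)
Definition stairdet m n : R :=
  \det (\matrix_(a < n, b < n) elem_symz x (a.*2.+1%:Z - b%:Z) (m + a).+1).

(* Interpolates between the determinants for [(m, n)] and [(m + 1, n - 1)]: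
   the degrees in the last [t] rows have been lowered by one. *)
Definition stairmx m n t : 'M[R]_n :=
  \matrix_(a < n, b < n)
    elem_symz x (a.*2%:Z + (a + t < n)%:Z - b%:Z) (m + a).+1.

(** The degree [2a + 1 - b] exceeds the number [a + 1] of variables as soon as [b < a], so the
    matrix is triangular. On the diagonal the two agree, which leaves the product of these
    variables. *)
Lemma stairdet0 n : stairdet 0 n = \prod_(1 <= i < n.+1) x i ^+ (n.+1 - i).
Proof.
rewrite /stairdet -det_tr det_trig; last first.
  by apply/is_trig_mxP => a b ab; rewrite !mxE elem_symz_gt //; lia.
rewrite (eq_bigr (fun a : 'I_n => \prod_(1 <= j < a.+2) x j)) => [|a _].
  elim: n => [|n IH]; first by rewrite big_ord0 big_nil.
  rewrite big_ord_recr /= IH [in RHS]big_nat_recr //= subSnn expr1.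
  rewrite [X in _ * X]big_nat_recr //= mulrA -big_split /=; congr (_ * _).
  by apply: eq_big_nat => i /andP[_ i_n]; rewrite -exprSr -subSn // ltnW.
rewrite !mxE add0n -elem_symzn; congr (elem_symz _ _ _); lia.
Qed.

Lemma stairmx0 m n : \det (stairmx m n 0) = stairdet m n.
Proof.
congr (\det _); apply/matrixP => a b; rewrite !mxE addn0 ltn_ord.
by congr (elem_symz _ _ _); lia.
Qed.

(** With all degrees lowered, row 0 is [(1, 0, ..., 0)]; deleting it and column 0 leaves the smaller
    staircase matrix with one more variable in each row. *)
Lemma stairmxn m n : \det (stairmx m n.+1 n.+1) = stairdet m.+1 n.
Proof.
rewrite (expand_det_row _ ord0) big_ord_recl big1 ?addr0 => [|b _].
  rewrite !mxE /cofactor expr0 [elem_symz _ _ _](_ : _ = 1) ?mul1r; last first.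
    by rewrite add0n ltnn -[RHS](elem_symz0 x (m + 0).+1).
  congr (\det _); apply/matrixP => a b; rewrite !mxE /= /bump /=.
  by congr (elem_symz _ _ _); lia.
by rewrite !mxE elem_symz_lt0 ?mul0r //= /bump /=; lia.
Qed.

(** Only row [n - t - 1] is flagged by exactly [m + (n - t)] variables, so the divided difference
    acts on that row alone and lowers its degrees by one. *)
Lemma stairmx_divdiff (s : {rmorphism R -> R}) m n t :
  (t < n)%N -> (forall j, s (x j.+1) = x (swap_nat (m + (n - t))%N j.+1)) ->
  (x (m + (n - t))%N - x (m + (n - t)).+1) * \det (stairmx m n t.+1)
  = \det (stairmx m n t) - s (\det (stairmx m n t)).
Proof.
move=> tn sx; set i := (m + (n - t))%N in sx *.
have i0 : (0 < i)%N by lia.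
have a0P : ((n - t).-1 < n)%N by lia.
pose a0 := Ordinal a0P.
pose B : 'M[R]_n := \matrix_(a, b) if a == a0
  then elem_symz x (a.*2%:Z - b%:Z) (m + a) else stairmx m n t a b.
have a0N (a : 'I_n) : a != a0 -> (a + t).+1 != n.
  by apply: contraNneq => e; apply/eqP/val_inj => /=; lia.
(* The divided difference of row [a0] involves one variable too few; adding
   [x i] times row [a0 - 1] restores it. *)
have -> : \det (stairmx m n t.+1) = \det B.
  (* Row 0 has no predecessor, but there the missing terms have negative degree [- b - 1] and
     vanish. *)
  have [a00|/= a0_gt0] := posnP a0.
    congr (\det _); apply/matrixP => a b; rewrite !mxE.
    case: (eqVneq a a0) => [->|/a0N an]; last first.
      by congr (elem_symz _ (_ + _ - _) _); lia.
    rewrite (_ : (_ < n)%N = false) ?addr0; last by rewrite /=; lia.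
    rewrite elem_symzS (@elem_symz_lt0 _ _ (_ - 1)) ?mulr0 ?addr0 //.
    rewrite a00 double0; lia.
  have a1P : (a0.-1 < n)%N by rewrite /=; lia.
  apply: (@det_add_row _ (x i) _ a0 (Ordinal a1P))
    => [|a b /[dup] aa0 /a0N an|b].
  - by apply/eqP => /(congr1 val) /=; lia.
  - by rewrite !mxE (negbTE aa0);
    congr (elem_symz _ (_ + _ - _) _); clear aa0; lia.
  rewrite !mxE eqxx ifN; last by apply/eqP => /(congr1 val) /=; lia.
  rewrite (_ : (a0 + t.+1 < n)%N = false) ?addr0 /=; last by rewrite /=; lia.
  have -> : ((n - t).-1.-1 + t < n)%N by lia.
  have -> : (m + (n - t).-1).+1 = i by lia.
  have -> : (m + (n - t).-1.-1).+1 = i.-1 by lia.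
  have -> : (m + (n - t).-1)%N = i.-1 by lia.
  rewrite -[in LHS](prednK i0) elem_symzS prednK //.
  by congr (_ + _ * elem_symz _ _ _); lia.
rewrite (det_divdiff_row (s := s) (a0 := a0) (A := stairmx m n t)) //.
  by move=> a b aa0; rewrite !mxE (negbTE aa0) (swap_elem_symz i0 sx) //;
    have := a0N a aa0; lia.
move=> b; rewrite !mxE eqxx /=.
have -> : (m + (n - t).-1).+1 = i by lia.
have -> : ((n - t).-1 + t < n)%N by lia.
by rewrite -(divdiff_elem_symz i0 sx); congr (_ * elem_symz _ _ _); lia.
Qed.

End Staircase.

(** * Stable sequences *)

Lemma iter_gamma_indexE m a i : iter m gamma_index a i = a (i - m%:Z).
Proof.
elim: m i => [|m IH] i; first by rewrite subr0.
rewrite iterS gamma_indexE IH; congr (fun_of_fsfun _ _); lia.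
Qed.

Lemma iter_gamma_index_with m (a : Cindex) k q :
  iter m gamma_index [fsfun a with k |-> q]
  = [fsfun iter m gamma_index a with k + m%:Z |-> q].
Proof.
apply/fsfunP => i; rewrite iter_gamma_indexE !fsfun_withE iter_gamma_indexE.
by rewrite subr_eq.
Qed.

Lemma gamma_index_surj a : exists b, gamma_index b = a.
Proof.
exists [fsfun i in [fset j - 1 | j in finsupp a] => a (i + 1) | 0%N].
apply/fsfunP => i; rewrite gamma_indexE fsfun_fun subrK.
case: ifP => // /negP ni; rewrite fsfun_dflt //.
by apply: contra_notN ni => ia; apply/imfsetP; exists i.
Qed.

Lemma Cindex_bound (a : Cindex) (k : int) :
  exists d : nat, forall i, k + d%:Z <= i -> a i = 0%N.
Proof.
pose M := (\max_(i <- finsupp a) `|i|)%N; exists (`|k| + M.+1)%N => i ki.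
rewrite fsfun_dflt //; apply/negP => ia.
have : (`|i| <= M)%N by exact: (@leq_bigmax_seq _ _ xpredT (fun j => absz j)).
by lia.
Qed.

Lemma admissible_iter_gamma (a : Cindex) :
  exists N, forall m, (N <= m)%N -> admissible (iter m gamma_index a).
Proof.
pose M := (\max_(i <- finsupp a) maxn `|i| (a i))%N.
have aM i : a i != 0%N -> (maxn `|i| (a i) <= M)%N.
  rewrite -mem_finsupp => ia.
  exact: (@leq_bigmax_seq _ _ xpredT (fun i => maxn (absz i) (a i))).
(* The support starts at [- M] or later, so the shift takes it to positions at least [M + 1], which
   are positive and exceed every value of [a]. *)
exists (M.*2.+1)%N => m Mm; split=> i; rewrite iter_gamma_indexE.
  by move=> i0; apply: contraTeq isT => /aM; lia.
by move=> _; case: (eqVneq (a (i%:Z - m%:Z)) 0%N) => [->//|/aM]; lia.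
Qed.

Section Stable.

Variables (R : comNzRingType) (x : nat -> R).

Definition semx (a : Cindex) : R :=
  \prod_(i <- finsupp a | 1 <= i) elem_symz x (a i) `|i|%N.

Lemma semxE (D : {fset int}) a : finsupp a `<=` D ->
  semx a = \prod_(i <- D) if 1 <= i then elem_symz x (a i) `|i|%N else 1.
Proof.
move=> aD; rewrite /semx big_mkcond; apply: big_fset_incl => // i _ ia.
by rewrite fsfun_dflt // elem_symz0 if_same.
Qed.

Lemma semx_with (a : Cindex) k q : 1 <= k ->
  semx [fsfun a with k |-> q]
  = elem_symz x q `|k|%N * semx [fsfun a with k |-> 0%N].
Proof.
move=> k1; have sub p : finsupp [fsfun a with k |-> p] `<=` k |` finsupp a.
  rewrite finsupp_with; case: ifP => _ //.
  by apply: fsubset_trans (fsubsetUr _ _); apply: fsubD1set.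
have kD : k \in k |` finsupp a by exact: fset1U1.
rewrite (semxE (sub q)) (semxE (sub 0%N)) [in LHS](big_fsetD1 k kD).
rewrite [in RHS](big_fsetD1 k kD) /= k1 !fsfun_with elem_symz0 mul1r.
 congr (_ * _); apply: eq_big_seq => i.
by rewrite !inE !fsfun_withE => /andP[/negbTE ->].
Qed.

Lemma swap_semx (s : {rmorphism R -> R}) (i : nat) (a : Cindex) :
  (0 < i)%N -> (forall j, s (x j.+1) = x (swap_nat i j.+1)) ->
  a i%:Z = 0%N -> s (semx a) = semx a.
Proof.
move=> i0 sx ai; rewrite /semx rmorph_prod; apply: eq_bigr => j j1.
have [ji|ji] := eqVneq `|j|%N i; last exact: swap_elem_symz i0 sx _ _ ji.
have -> : j = i by lia.
by rewrite ai elem_symz0 rmorph1.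
Qed.

(** The formal sum [g] records unshifted indices, so that a single [g] can serve for every [m]. *)
Definition sem_comb (m : nat) (g : {malg int[Cindex]}) : R :=
  mmap intr (fun a => semx (iter m gamma_index a)) g.

Definition stable (f : nat -> R) : Prop :=
  exists (g : {malg int[Cindex]}) (N : nat),
    forall m, (N <= m)%N -> f m = sem_comb m g.

Lemma eventually_stable N f f' :
  (forall m, (N <= m)%N -> f m = f' m) -> stable f -> stable f'.
Proof.
move=> ff' [g [M fg]]; exists g, (maxn N M) => m.
by rewrite geq_max => /andP[Nm Mm]; rewrite -ff' ?fg.
Qed.

Lemma eq_stable f f' : f =1 f' -> stable f -> stable f'.
Proof. by move=> ff'; apply: (@eventually_stable 0) => m _. Qed.

Lemma stable_semx a : stable (fun m => semx (iter m gamma_index a)).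
Proof. by exists << a >>, 0%N => m _; rewrite /sem_comb mmapU mul1r. Qed.

Lemma stableD f f' : stable f -> stable f' -> stable (fun m => f m + f' m).
Proof.
move=> [g [M fg]] [g' [M' fg']]; exists (g + g'), (maxn M M') => m.
by rewrite geq_max => /andP[? ?]; rewrite fg // fg' // /sem_comb raddfD.
Qed.

Lemma stableMz f (n : int) : stable f -> stable (fun m => n%:~R * f m).
Proof.
move=> [g [M fg]]; exists (g *~ n), M => m Mm.
by rewrite fg // /sem_comb raddfMz mulrzl.
Qed.

Lemma stableN f : stable f -> stable (fun m => - f m).
Proof. by move/(stableMz (-1)); apply: eq_stable => m; rewrite mulN1r. Qed.

Lemma stable0 : stable (fun=> 0).
Proof. by exists 0, 0%N => m _; rewrite /sem_comb raddf0. Qed.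

Lemma stable_sum (I : Type) (r : seq I) (F : I -> nat -> R) :
  (forall i, stable (F i)) -> stable (fun m => \sum_(i <- r) F i m).
Proof.
move=> sF; elim: r => [|i r IH].
  by apply: eq_stable stable0 => m; rewrite big_nil.
by apply: eq_stable (stableD (sF i) IH) => m; rewrite big_cons.
Qed.

Lemma stable1 : stable (fun=> 1).
Proof.
apply: eq_stable (stable_semx [fsfun for fun=> 0%N]) => m.
have -> : iter m gamma_index [fsfun for fun=> 0%N] = [fsfun for fun=> 0%N].
  by apply/fsfunP => i; rewrite iter_gamma_indexE !fsfunE.
by rewrite (semxE (fsubset_refl _)) finsupp0 big_seq_fset0.
Qed.

(** The bound makes [k + m] positive, so this position contributes to [semx] and [absz] leaves it
    unchanged. *)
Lemma semx_iter_with m (a : Cindex) k q : (`|k| < m)%N ->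
  semx (iter m gamma_index [fsfun a with k |-> q])
  = elem_symz x q (absz (k + m%:Z)) *
    semx (iter m gamma_index [fsfun a with k |-> 0%N]).
Proof. by move=> km; rewrite !iter_gamma_index_with semx_with //; lia. Qed.

Lemma semx_iterE m (a : Cindex) k : (`|k| < m)%N ->
  semx (iter m gamma_index a) = elem_symz x (a k) (absz (k + m%:Z)) *
    semx (iter m gamma_index [fsfun a with k |-> 0%N]).
Proof. by move=> km; rewrite -semx_iter_with ?fsfun_with_id. Qed.

(** Induction on the width [d] of the part of [a] from [k] on, then on [q]. If that part is empty,
    the new factor simply becomes entry [k]; otherwise it is straightened against the factor already
    there. *)
Lemma stable_elem_symz_semx (d q : nat) (a : Cindex) (k : int) :
  (forall i, k + d%:Z <= i -> a i = 0%N) ->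
  stable (fun m => elem_symz x q (absz (k + m%:Z)) *
    semx (iter m gamma_index a)).
Proof.
elim: d q a k => [|d IHd] q a k ak.
  apply: (@eventually_stable `|k|.+1) (stable_semx [fsfun a with k |-> q])
    => m km.
  by rewrite (semx_iter_with _ _ km) -{2}(ak k) ?fsfun_with_id //; lia.
elim: q a ak => [|q IHq] a ak.
  by apply: eq_stable (stable_semx a) => m; rewrite elem_symz0 mul1r.
have akW p i : k + 1 + d%:Z <= i -> [fsfun a with k |-> p] i = 0%N.
  by move=> ki; rewrite fsfun_withE ifN ?ak //; [|apply/eqP]; lia.
have akW' p i : k + d.+1%:Z <= i -> [fsfun a with k |-> p] i = 0%N.
  by move=> ki; apply: akW; lia.
have ak' i : k + 1 + d%:Z <= i -> a i = 0%N by move=> ki; apply: ak; lia.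
(* These are the three terms of the straightening with [p = a k]. The first two multiply at [k + 1],
   where the width is smaller; the third multiplies at [k], with degree [q] in place of [q.+1]. *)
have s1 := IHd q.+1 a (k + 1) ak'.
have s2 := stableN (IHd (a k).+1 [fsfun a with k |-> q] (k + 1) (akW q)).
have s3 := IHq [fsfun a with k |-> (a k).+1] (akW' _).
apply: (@eventually_stable `|k|.+1) (stableD (stableD s1 s2) s3) => m km.
rewrite (semx_iterE a km) (semx_iter_with a q km) (semx_iter_with a _.+1 km).
have -> : absz (k + 1 + m%:Z) = (absz (k + m%:Z)).+1 by lia.
rewrite !mulrA -mulNr -!mulrDl; congr (_ * _).
rewrite [RHS]mulrC [RHS]elem_symz_straighten.
have -> : q.+1%:Z - 1 = q by lia.
have -> : (a k)%:Z + 1 = (a k).+1 by lia.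
by ring.
Qed.

Lemma stable_elem_symz (q k : int) f : stable f ->
  stable (fun m => elem_symz x q (absz (k + m%:Z)) * f m).
Proof.
move=> [g [M fg]]; case: q => q; last first.
  by apply: eq_stable stable0 => m; rewrite mul0r.
have sg (a : Cindex) := let: ex_intro d ad := Cindex_bound a k in
  stableMz g@_a (@stable_elem_symz_semx d q a k ad).
apply: (@eventually_stable M) (stable_sum (msupp g) sg) => m Mm.
by rewrite fg // /sem_comb mmapE mulr_sumr; apply: eq_bigr => a _;
  rewrite mulrCA.
Qed.

(** For a delay of one, each index is replaced by its preimage under [gamma_index], which needs one
    more shift to reach the same place. *)
Lemma stable_delay N f : stable f -> stable (fun m => f (m - N)%N).
Proof.
have shift1 h : stable h -> stable (fun m => h m.-1).
  move=> [g [M hg]].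
  have sg a : stable (fun m => (g@_a)%:~R * semx (iter m.-1 gamma_index a)).
    have [b <-] := gamma_index_surj a; apply: stableMz.
    apply: (@eventually_stable 1) (stable_semx b) => -[//|m] _.
    by rewrite iterSr.
  apply: (@eventually_stable M.+1) (stable_sum (msupp g) sg) => m Mm.
  by rewrite hg /sem_comb ?mmapE //; lia.
elim: N f => [|N IH] f sf; first by apply: eq_stable sf => m; rewrite subn0.
by apply: eq_stable (IH _ (shift1 _ sf)) => m; rewrite subnS.
Qed.

Lemma stable_prod_elem_symz (I : Type) (r : seq I) (q k : I -> int) :
  stable (fun m => \prod_(i <- r) elem_symz x (q i) (absz (k i + m%:Z))).
Proof.
elim: r => [|i r IH].
  by apply: eq_stable stable1 => m; rewrite big_nil.
by apply: eq_stable (stable_elem_symz (q i) (k i) IH) => m; rewrite big_cons.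
Qed.

(** In the Leibniz expansion the terms and their degrees depend on [n] only; [m] enters just as a
    shift of the numbers of variables. *)
Lemma stable_stairdet n : stable (fun m => stairdet x m n).
Proof.
pose F (s : {perm 'I_n}) m : R := ((-1) ^+ s : int)%:~R *
  \prod_(a <- enum 'I_n)
    elem_symz x (a.*2.+1%:Z - (s a)%:Z) (absz (a.+1%:Z + m%:Z)).
have sF s : stable (F s) by apply/stableMz/stable_prod_elem_symz.
apply: eq_stable (stable_sum (index_enum {perm 'I_n}) sF) => m.
apply: eq_bigr => s _; rewrite /F rmorphXn rmorphN1 big_enum /=; congr (_ * _).
by apply: eq_bigr => a _; rewrite mxE; congr (elem_symz _ _ _); lia.
Qed.

(** Once the factor at [k] is isolated, the exchange fixes the rest of each SEM. The exchanged
    variables move with [m], hence a family [s]. *)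
Lemma stable_divdiff (s : nat -> {rmorphism R -> R}) (k : int) f :
  (forall i j, s i (x j.+1) = x (swap_nat i j.+1)) -> stable f ->
  exists2 h, stable h & exists N, forall m i, (N <= m)%N -> k + m%:Z = i%:Z ->
    (x i - x i.+1) * h m = f m - s i (f m).
Proof.
move=> sx [g [M fg]].
pose h (a : Cindex) m := elem_symz x ((a k)%:Z - 1) (absz (k - 1 + m%:Z)) *
  semx (iter m gamma_index [fsfun a with k |-> 0%N]).
have sh a : stable (fun m => (g@_a)%:~R * h a m).
  by apply/stableMz/stable_elem_symz/stable_semx.
exists (fun m => \sum_(a <- msupp g) (g@_a)%:~R * h a m).
  exact: stable_sum.
exists (maxn M `|k|.+1) => m i; rewrite geq_max => /andP[Mm km] ki.
have i0 : (0 < i)%N by lia.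
rewrite fg // /sem_comb mmapE rmorph_sum -sumrB mulr_sumr.
apply: eq_bigr => a _.
rewrite rmorphM rmorph_int -mulrBr mulrCA; congr (_ * _).
rewrite (semx_iterE a km) /h ki rmorphM (swap_semx i0 (sx i)); last first.
  by rewrite iter_gamma_indexE -ki addrK fsfun_with.
have -> : absz (k - 1 + m%:Z) = i.-1 by lia.
by rewrite -mulrBl -(divdiff_elem_symz i0 (sx i)) mulrA.
Qed.

End Stable.

(** * Schubert polynomials *)

Lemma longestE n i :
  longest n i = if (1 <= i) && (i <= n%:Z) then n%:Z + 1 - i else i.
Proof. exact: sz_of_funE. Qed.

(* Carries the value 1 of the longest element of S_(N+1) from position [N + 1]
   to position [N + 1 - t]. *)
Fixpoint slide_min (N t : nat) : SZ :=
  if t is t'.+1 then szM (slide_min N t') (adj (N - t')%N%:Z)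
  else longest N.+1.

Lemma slide_minE N t i : (t <= N)%N ->
  slide_min N t i =
    if (i <= 0) || (N.+1%:Z < i) then i
    else if i < N.+1%:Z - t%:Z then N.+2%:Z - i
    else if i == N.+1%:Z - t%:Z then 1 else N.+3%:Z - i.
Proof.
elim: t i => [|t IH] i tN; first by rewrite longestE; do !case: ifP; lia.
rewrite szM_adjE /adj_fun !IH; try lia.
case: (i =P (N - t)%N%:Z) => [->|?]; first by do !case: ifP; lia.
by case: (i =P (N - t)%N%:Z + 1) => [->|?]; do !case: ifP; lia.
Qed.

Lemma slide_min_last N : slide_min N N = gamma (longest N).
Proof.
apply/szP => i; rewrite slide_minE // sz_of_funE /gamma_fun longestE.
by do !case: ifP; lia.
Qed.

Lemma in_Sinfty_iter_gamma c d m w :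
  fixes_outside c d w -> 1 - m%:Z <= c -> in_Sinfty (iter m gamma w).
Proof.
move=> wP mc i i0; rewrite iter_gammaE wP ?subrK //.
by apply/negP => /andP[? _]; lia.
Qed.

Section Schubert.

Variables (S : SZ -> Qx) (hS : schubert_family S).

Lemma schubert_divdiff c d m (u : SZ) i j :
  fixes_outside c d u -> 1 - m%:Z <= c -> (0 < j)%N -> i + m%:Z = j%:Z ->
  u (i + 1) < u i ->
  divdiff j (S (iter m gamma u)) (S (iter m gamma (szM u (adj i)))).
Proof.
move=> uP mc j0 ij ui; rewrite iter_gammaM_adj ij.
apply: hS.2 => //; first exact: in_Sinfty_iter_gamma uP mc.
apply: length_lt_descent; rewrite !iter_gammaE -ij addrAC !addrK.
by rewrite ltrD2r.
Qed.

Lemma fixes_outside_slide_min N t : (t <= N)%N ->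
  fixes_outside 1 N.+2%:Z (slide_min N t).
Proof. by move=> tN i ni; rewrite slide_minE // ifT //; lia. Qed.

(** From [m] to [m.+1]: [n.+1] divided differences lead from the longest element of the next larger
    group to the shifted one. Each matches one step of [stairmx], and uniqueness of the quotient
    identifies the results. *)
Lemma schubert_staircase m n :
  S (iter m gamma (longest n.+1)) = stairdet xvar m n.
Proof.
elim: m n => [|m IHm] n; first by rewrite hS.1 stairdet0.
rewrite iterSr -slide_min_last -stairmxn.
suff: forall t, (t <= n.+1)%N ->
    S (iter m gamma (slide_min n.+1 t)) = \det (stairmx xvar m n.+1 t).
  by apply.
elim=> [_|t IHt tn]; first by rewrite stairmx0 IHm.
set j := (m + (n.+1 - t))%N.
have j0 : (0 < j)%N by rewrite /j; lia.
apply: (divdiff_inj j0 (f := \det (stairmx xvar m n.+1 t))).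
  rewrite -IHt; last exact: ltnW.
  apply: (schubert_divdiff (fixes_outside_slide_min (ltnW tn))) => //; try lia.
  rewrite !slide_minE; try exact: ltnW.
  by do !case: ifP; lia.
by apply: (stairmx_divdiff (s := swap j)) => // k; exact: swap_xvar.
Qed.

(** Injectivity makes the descents strict. Counting down from position 1 bounds the values above,
    counting up from position [n + 1] bounds them below, and the bounds coincide. *)
Lemma no_ascent_longest n (w : SZ) : fixes_outside 1 n.+2%:Z w ->
  (forall k : nat, (k < n)%N -> w (k.+1%:Z + 1) <= w k.+1%:Z) ->
  w = longest n.+1.
Proof.
move=> wP wD.
have w_lt k : (k < n)%N -> w k.+2%:Z < w k.+1%:Z.
  move=> kn; have e : k.+2%:Z = k.+1%:Z + 1 by lia.
  rewrite e lt_neqAle wD // andbT; apply/eqP => /sz_inj; lia.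
have win k : (k <= n)%N -> 1 <= w k.+1%:Z < n.+2%:Z.
  by move=> kn; apply: (fixes_outside_stable wP); lia.
have up k : (k <= n)%N -> w k.+1%:Z <= n.+1%:Z - k%:Z.
  elim: k => [|k IH] kn; first by have := win 0%N kn; lia.
  by have := w_lt k kn; have := IH (ltnW kn); lia.
have down k : (k <= n)%N -> k.+1%:Z <= w (n - k).+1%:Z.
  elim: k => [|k IH] kn; first by have := win n (leqnn n); rewrite subn0; lia.
  have := w_lt (n - k.+1)%N; rewrite -subSn // subSS.
  by have := IH (ltnW kn); lia.
apply/szP => i; rewrite longestE; case: ifP => [|i_out]; last first.
  by apply: wP; move: i_out; lia.
case: i => // -[|k] // kn; have {}kn : (k <= n)%N by lia.
have := down (n - k)%N; rewrite subKn // => /(_ (leq_subr _ _)).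
by have := up k kn; lia.
Qed.

(** Induction on a bound for the inversions still missing: exchanging at an ascent of [w] gives a
    [u] with one more inversion, and the polynomials of [w] are divided differences of those of
    [u]. *)
Lemma stable_schubert_window n (w : SZ) : fixes_outside 1 n.+2%:Z w ->
  stable xvar (fun m => S (iter m gamma w)).
Proof.
set I := int_range 1 n.+1.
have [d] := ubnP (#|` I `*` I| - #|` inversions w|)%N.
elim: d w => // d IH w wd wP.
case: (boolP [exists k : 'I_n, w k.+1%:Z < w (k.+1%:Z + 1)]); last first.
  rewrite negb_exists => /forallP wD.
  have -> : w = longest n.+1.
    by apply: no_ascent_longest wP _ => k kn; rewrite leNgt (wD (Ordinal kn)).
  by apply: eq_stable (stable_stairdet xvar n) => m; rewrite schubert_staircase.
move=> /existsP[k wk]; set i : int := k.+1%:Z in wk.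
set u := szM w (adj i).
have ui : u (i + 1) < u i by rewrite !szM_adjE adj_funl adj_funr.
have uP : fixes_outside 1 n.+2%:Z u.
  by apply: fixes_outsideM_adj => //; have := ltn_ord k; rewrite /i; lia.
have cu := card_inversions_descent ui.
have /IH/(_ uP) su : (#|` I `*` I| - #|` inversions u| < d)%N.
  rewrite szM_adjK in cu.
  have := card_inversions_le (c := 1) (n := n.+1) (u := u).
  by rewrite (_ : 1 + n.+1%:Z = n.+2) // -/I => /(_ uP); lia.
have [h sh [N hN]] := stable_divdiff (s := fun j => swap j) i swap_xvar su.
apply: (@eventually_stable _ _ N) sh => m Nm.
have im : i + m%:Z = (k.+1 + m)%N by [].
apply: (divdiff_inj (f := S (iter m gamma u))); last first.
- rewrite -(szM_adjK w i); apply: (schubert_divdiff uP _ _ im ui) => //.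
  by lia.
- exact: hN Nm im.
- by [].
Qed.

Lemma fixes_outside_iter_gamma c d m w : fixes_outside c d w ->
  fixes_outside (c + m%:Z) (d + m%:Z) (iter m gamma w).
Proof.
move=> wP i i_out; rewrite iter_gammaE wP ?subrK //.
by apply: contra i_out => ?; lia.
Qed.

Lemma stable_schubert w : stable xvar (fun m => S (iter m gamma w)).
Proof.
(* This shift moves the left end [- radius w] of the window to 1; the delay by [r] then compensates
   for it. *)
pose r := (radius w).+1.
have wP : fixes_outside 1 (radius w).*2.+2%:Z (iter r gamma w).
  have := fixes_outside_iter_gamma (m := r) (@fixes_outside_radius w).
  move=> h i i_out; apply: h; apply: contra i_out; rewrite /r; lia.
apply: (@eventually_stable _ _ r) (stable_delay r (stable_schubert_window wP)).
by move=> m rm; rewrite -iterD subnK.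
Qed.

End Schubert.

Theorem corollary3p8 (Schubert : SZ -> Qx) (hS : schubert_family Schubert)
    (w : SZ) :
  exists (m0 : nat) (A : {fset Cindex}) (c : Cindex -> rat),
    (forall a : Cindex, a \in A -> c a != 0)
    /\ (forall m : nat, (m0 <= m)%N ->
          [/\ in_Sinfty (iter m gamma w),
              forall a : Cindex, a \in A -> admissible (iter m gamma_index a)
            & Schubert (iter m gamma w)
              = \sum_(a <- A) c a *: sem (iter m gamma_index a)]).
Proof.
have [g [N Sg]] := stable_schubert hS w.
have adm (s : seq Cindex) : exists M, forall m, (M <= m)%N ->
    {in s, forall a, admissible (iter m gamma_index a)}.
  elim: s => [|a s [M IH]]; first by exists 0%N.
  have [M' aM'] := admissible_iter_gamma a.
  exists (maxn M M') => m; rewrite geq_max => /andP[Mm M'm] b.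
  by rewrite inE => /predU1P[->|bs]; [exact: aM' | exact: (IH m Mm b bs)].
have [M admM] := adm (msupp g).
(* The three thresholds make the window of [w] positive, the expansion valid and all indices
   admissible. Restriction to the support of [g] keeps the coefficients nonzero. *)
exists (maxn (radius w).+1 (maxn N M)), (msupp g), (fun a => (g@_a)%:~R).
split=> [a|m]; first by rewrite intr_eq0 mcoeff_neq0.
rewrite !geq_max => /and3P[rm Nm Mm]; split; last first.
- rewrite Sg // /sem_comb mmapE; apply: eq_bigr => a _.
  by rewrite scaler_int mulrzl.
- exact: admM Mm.
- by apply: in_Sinfty_iter_gamma (@fixes_outside_radius w) _; lia.
Qed.
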